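(* Let $n$ be a positive integer that is not of the form $p^m$ with $p$ a prime and $m$ a non-negative integer. Let $C_n$ be the cyclic group of order $n$ and let $\lambda_2(\mathcal{P}(C_n))$ be the second largest eigenvalue of its power graph $\mathcal{P}(C_n)$. Then $\lambda_2(\mathcal{P}(C_n))>0$.
   Context: The power graph $\mathcal{P}(\mathbb{G})$ of a finite group $\mathbb{G}$ is the simple undirected graph with vertex set $\mathbb{G}$ in which two distinct elements $x,y$ are adjacent if and only if one of them is an integral power of the other. The eigenvalues of a graph $G$ on $N$ vertices are those of its adjacency matrix, listed with multiplicity as $\lambda_1(G)\ge\lambda_2(G)\ge\cdots\ge\lambda_N(G)$; $\lambda_2(G)$ is the second largest eigenvalue. *)

(* Defs.v *)
From HB Require Import structures.
From mathcomp Require Import all_boot all_order all_algebra all_fingroup all_solvable.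
From mathcomp Require Import polyrcf.
Set Implicit Arguments.
Unset Strict Implicit.
Unset Printing Implicit Defensive.
Import Order.TTheory GRing.Theory Num.Theory.
Local Open Scope ring_scope.

Definition power_graph (gT : finGroupType) : rel gT :=
  [rel x y | (x != y) && ((x \in <[y]>%g) || (y \in <[x]>%g))].

Lemma power_graphP (gT : finGroupType) (x y : gT) :
  reflect (x <> y /\ ((exists k, x = y ^+ k \/ x = y ^- k)%g \/
                      (exists k, y = x ^+ k \/ y = x ^- k)%g))
          (power_graph x y).
Proof.
have zcycleP (u v : gT) :
    reflect (exists k, u = v ^+ k \/ u = v ^- k)%g (u \in <[v]>%g).
  apply: (iffP idP) => [/cycleP[k ->]|[k [] ->]]; first by exists k; left.
    exact: mem_cycle.
  by rewrite groupV mem_cycle.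
apply: (iffP andP) => -[/eqP xNy] => [/orP|] xy; split=> //; last apply/orP.
all: by case: xy => /zcycleP; [left | right].
Qed.

Definition adjacency (R : pzSemiRingType) (T : finType) (e : rel T) : 'M[R]_#|T| :=
  \matrix_(i, j) (e (enum_val i) (enum_val j))%:R.

(* The roots in R of the characteristic polynomial, repeated according to
   multiplicity, in non-increasing order. [rootsR] lists each root once. *)
Definition eigenvalues (R : rcfType) (n : nat) (A : 'M[R]_n) : seq R :=
  sort >=%O (flatten [seq nseq (mup x (char_poly A)) x | x <- rootsR (char_poly A)]).

Lemma count_mem_eigenvalues (R : rcfType) (n : nat) (A : 'M[R]_n) (x : R) :
  count_mem x (eigenvalues A) = mup x (char_poly A).
Proof.
have pN0 : char_poly A != 0 by rewrite monic_neq0 ?char_poly_monic.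
have memr : (x \in rootsR (char_poly A)) = root (char_poly A) x.
  by rewrite -(roots_on_rootsR pN0) in_itv.
have cnt (s : seq R) (m : R -> nat) : uniq s ->
    count_mem x (flatten [seq nseq (m y) y | y <- s]) = ((x \in s) * m x)%N.
  elim: s => //= y s IHs /andP[yNs us].
  rewrite count_cat count_nseq IHs // in_cons /= (eq_sym y x).
  have [->|_] := eqVneq x y; last by rewrite mul0n.
  by rewrite (negPf yNs) !mul1n mul0n addn0.
rewrite /eigenvalues count_sort cnt ?uniq_roots // memr.
by case: (boolP (root _ _)) => [_|/mupNroot->]; rewrite ?mul1n.
Qed.

(* [lambda A k] is the k-th largest eigenvalue, counting from k = 1. *)
Definition lambda (R : rcfType) (n : nat) (A : 'M[R]_n) (k : nat) : R :=
  (eigenvalues A)`_k.-1.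

(* Main.v *)
Require Import Defs.
From mathcomp Require Import all_boot all_order all_algebra all_fingroup all_solvable.
From mathcomp Require Import spectral complex ring.
Set Implicit Arguments.
Unset Strict Implicit.
Unset Printing Implicit Defensive.
Import Order.TTheory GRing.Theory Num.Theory.
Local Open Scope ring_scope.
Local Open Scope sesquilinear_scope.

(** If the order of a group is not a prime power, two distinct primes divide it,
    and one of them, say [p], is odd; let [q] be the other. By Cauchy's theorem
    there are elements [x] of order [p] and [y] of order [q]. Since [p > 2], the
    elements [1, x, x^-1] are distinct and form a triangle of the power graph.
    The vertex [y] is adjacent to [1], but not to [x] or [x^-1]: adjacent
    elements have orders of which one divides the other. So the power graph
    contains the paw, a triangle with a pendant edge, as an induced subgraph.

    The paw has two positive eigenvalues, and by interlacing so does every graph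
    that contains it as an induced subgraph. This takes the following form.
    By the spectral theorem a real symmetric matrix [A] is, over the complex
    numbers, unitarily similar to a diagonal matrix with real entries, and these
    entries are the eigenvalues of [A] ([symmetric_spectral],
    [char_poly_unitary_diag]). If the quadratic form of [A] is positive definite
    on the row space of a matrix with [k] rows, then [A] has at least [k]
    positive eigenvalues ([eigenvalues_posdef]); otherwise a dimension count
    would give a nonzero vector of that space with no component along the
    eigenvectors of positive eigenvalue. For the paw, two explicit vectors span a
    plane on which the form is a sum of squares ([lambda2_gt0_paw]). *)

(** * Spectra of real symmetric matrices *)

(** A real symmetric matrix is Hermitian over [R[i]], where the spectral theorem
    for normal matrices applies; the spectrum of a Hermitian matrix is real, so
    the diagonal can be taken in [R]. *)
Lemma symmetric_spectral (R : rcfType) (n : nat) (A : 'M[R]_n) : A^T = A ->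
  exists (U : 'M[R[i]]_n) (d : 'rV[R]_n), U \is unitarymx /\
    map_mx (real_complex R) A =
      U^t* *m diag_mx (map_mx (real_complex R) d) *m U.
Proof.
move=> symA; set B := map_mx _ A.
have Bherm : B \is hermsymmx.
  apply: realsym_hermsym.
    apply/is_hermitianmxP; rewrite expr0 scale1r; apply/matrixP=> i j.
    by rewrite !mxE -[in LHS]symA mxE.
  by apply/mxOverP=> i j; rewrite mxE; apply/complex_realP; exists (A i j).
have /orthomx_spectralP BE := hermitian_normalmx Bherm.
have Bdr := hermitian_spectral_diag_real Bherm.
exists (spectralmx B), (map_mx (@complex.Re R) (spectral_diag B)).
split; first exact: spectral_unitarymx.
rewrite {1}BE invmx_unitary ?spectral_unitarymx //; congr (_ *m diag_mx _ *m _).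
by apply/matrixP=> i j; rewrite !mxE RRe_real // (mxOverP Bdr).
Qed.

Lemma char_poly_conjV (F : fieldType) (n : nat) (P A : 'M[F]_n) :
  P \in unitmx -> char_poly (invmx P *m A *m P) = char_poly A.
Proof.
move=> uP; have uPX : map_mx polyC P \in unitmx by rewrite map_unitmx.
rewrite /char_poly /char_poly_mx !map_mxM /= map_invmx.
set Q := map_mx polyC P in uPX *.
have XE : invmx Q *m 'X%:M *m Q = 'X%:M by rewrite scalar_mxC mulmxKV.
rewrite -[in LHS]XE -mulmxBl -mulmxBr !det_mulmx mulrAC -det_mulmx mulVmx //.
by rewrite det1 mul1r.
Qed.

Lemma char_poly_unitary_diag (R : rcfType) (n : nat) (A : 'M[R]_n)
    (U : 'M[R[i]]_n) (d : 'rV[R]_n) : U \is unitarymx ->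
    map_mx (real_complex R) A =
      U^t* *m diag_mx (map_mx (real_complex R) d) *m U ->
  char_poly A = \prod_(i < n) ('X - (d 0 i)%:P).
Proof.
move=> unU AE; apply: (@map_poly_inj _ _ (real_complex R)).
rewrite map_char_poly AE rmorph_prod -invmx_unitary //.
rewrite char_poly_conjV ?unitarymx_unit //.
rewrite char_poly_trig ?diag_mx_is_trig //.
apply: eq_bigr => i _.
by rewrite !mxE eqxx mulr1n rmorphB /= map_polyX map_polyC.
Qed.

Lemma perm_eigenvalues (R : rcfType) (n : nat) (A : 'M[R]_n) (s : seq R) :
  char_poly A = \prod_(x <- s) ('X - x%:P) -> perm_eq (eigenvalues A) s.
Proof.
move=> AE; apply/allP=> x _ /=.
by rewrite count_mem_eigenvalues AE mu_prod_XsubC.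
Qed.

(** In a non-increasing list the positive terms come first, so the term of index
    [k], counting from 0, is positive as soon as there are more than [k]. *)
Lemma lambda_gt0 (R : rcfType) (n : nat) (A : 'M[R]_n) (k : nat) :
  (k < count (> 0)%R (eigenvalues A))%N -> 0 < lambda A k.+1.
Proof.
rewrite /lambda /=; set s := eigenvalues A => lt_k; rewrite ltNge.
have sorted_s : sorted >=%O s.
  by apply: sort_sorted => x y; exact: ge_total.
apply: contraTN lt_k => sk; rewrite -leqNgt -(cat_take_drop k s) count_cat.
rewrite [X in (_ + X)%N](_ : _ = 0)%N ?addn0.
  by rewrite (leq_trans (count_size _ _)) // size_take_min geq_minl.
apply/eqP; rewrite -leqn0 leqNgt -has_count -all_predC.
apply/(all_nthP 0) => i; rewrite size_drop nth_drop => lt_i /=.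
have lt_ki : (k + i < size s)%N by rewrite -ltn_subRL.
rewrite -leNgt (le_trans _ sk) //.
apply: (sorted_leq_nth _ _ 0 sorted_s) => //.
- by move=> x y z; exact: ge_trans.
- by move=> x; exact: lexx.
- by rewrite inE (leq_ltn_trans (leq_addr i k)).
- exact: leq_addr.
Qed.

(** For [z = x + i y] the form at [z] is the sum of its values at [x] and [y],
    because the two mixed terms cancel when [H] is symmetric. *)
Lemma posdef_conj (R : rcfType) (m : nat) (H : 'M[R]_m) : H^T = H ->
  (forall v : 'rV_m, v != 0 -> 0 < (v *m H *m v^T) 0 0) ->
  forall z : 'rV[R[i]]_m, z != 0 ->
    0 < (z *m map_mx (real_complex R) H *m z^t* ) 0 0.
Proof.
move=> symH posH z zN0.
set x := map_mx (@complex.Re R) z; set y := map_mx (@complex.Im R) z.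
pose C m n (M : 'M_(m, n)) := map_mx (real_complex R) M.
have zE : z = C _ _ x + 'i%C *: C _ _ y.
  by apply/matrixP=> i j; rewrite !mxE -complexE.
have ztE : z^t* = C _ _ x^T - 'i%C *: C _ _ y^T.
  have conjE (c : R[i]) :
      Num.conj c = (complex.Re c)%:C%C - 'i%C * (complex.Im c)%:C%C.
    by case: c => a b; rewrite [LHS]complexE /= rmorphN mulrN.
  by apply/matrixP=> i j; rewrite !mxE conjE.
have xy : x *m H *m y^T = y *m H *m x^T.
  have tr11 (M : 'M[R]_1) : M^T = M by apply/matrixP=> i j; rewrite !ord1 mxE.
  by rewrite -[LHS]tr11 !trmx_mul trmxK symH mulmxA.
have posH0 (v : 'rV_m) : 0 <= (v *m H *m v^T) 0 0.
  by have [->|/posH/ltW//] := eqVneq v 0; rewrite !mul0mx mxE.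
have -> : (z *m C _ _ H *m z^t* ) 0 0 =
          ((x *m H *m x^T) 0 0 + (y *m H *m y^T) 0 0)%:C%C.
  rewrite ztE {1}zE !(mulmxDl, mulmxBr) -!(scalemxAl, scalemxAr) -!map_mxM xy.
  move: (x *m H *m x^T) (y *m H *m x^T) (y *m H *m y^T) => a b c.
  have i2 : 'i%C * 'i%C = -1 :> R[i] by rewrite -expr2 sqr_i.
  by rewrite !mxE rmorphD /=; ring: i2.
rewrite ltcR.
have [x0|/posH xN0] := eqVneq x 0; last by rewrite ltr_wpDr.
have yN0 : y != 0.
  by apply: contra_neq zN0 => y0; rewrite zE x0 y0 /C !map_mx0 scaler0 addr0.
by rewrite ltr_wpDl ?posH.
Qed.

(** One half of Sylvester's law of inertia: in coordinates [w] with respect to an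
    orthonormal eigenbasis the form is [\sum_i d_i |w_i|^2]. If fewer than [k] of
    the [d_i] are positive, some nonzero combination of the rows of [B] has
    [w_i = 0] for all of them, and the form is at most 0 there. *)
Lemma eigenvalues_posdef (R : rcfType) (n k : nat) (A : 'M[R]_n)
    (B : 'M[R]_(k, n)) : A^T = A ->
    (forall v : 'rV_k, v != 0 -> 0 < (v *m (B *m A *m B^T) *m v^T) 0 0) ->
  (k <= count (> 0)%R (eigenvalues A))%N.
Proof.
move=> symA posB; have [U [d [unU AE]]] := symmetric_spectral symA.
have eigA : perm_eq (eigenvalues A) [seq d 0 i | i : 'I_n].
  apply: perm_eigenvalues; rewrite (char_poly_unitary_diag unU AE).
  by rewrite big_map big_enum.
rewrite (seq.permP eigA) count_map -size_filter.
rewrite (_ : size _ = #|[pred i | d 0 i > 0]|); last first.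
  by rewrite cardE enumT.
set S := [pred i | _]; rewrite leqNgt; apply/negP => ltSk.
set BU := map_mx (real_complex R) B *m U^t*.
(* The rows of BU are the rows of B in the eigenbasis; a vector of K combines
   them so that the coordinates of index in S vanish. *)
pose K := kermx (colsub (enum_val : 'I_#|S| -> 'I_n) BU).
have KN0 : K != 0.
  rewrite -mxrank_eq0 mxrank_ker -lt0n subn_gt0.
  exact: leq_ltn_trans (rank_leq_col _) ltSk.
have [z /sub_kermxP zK zN0] := rowV0Pn KN0.
set w := z *m BU.
have w0 i : d 0 i > 0 -> w 0 i = 0.
  move=> di_gt0; have iS : i \in S by [].
  have /rowP/(_ (enum_rank_in iS i)) := zK.
  by rewrite mulmx_colsub !mxE enum_rankK_in.
have symH : (B *m A *m B^T)^T = B *m A *m B^T.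
  by rewrite !trmx_mul trmxK symA mulmxA.
have /lt_geF/negP := posdef_conj symH posB zN0; apply.
have -> : z *m map_mx (real_complex R) (B *m A *m B^T) *m z^t* =
    w *m diag_mx (map_mx (real_complex R) d) *m w^t*.
  rewrite /w /BU !map_mxM AE !trmx_mul !map_mxM trmxCK !mulmxA.
  congr (_ *m _); apply: congr1; apply/matrixP=> i j; rewrite !mxE.
  by apply/esym/CrealP/complex_realP; exists (B j i).
clearbody w.
rewrite mul_mx_diag mxE sumr_le0 // => i _; rewrite !mxE.
have [/w0->|di_le0] := ltP 0 (d 0 i); first by rewrite !mul0r.
by rewrite mulrAC mulr_ge0_le0 ?mul_conjC_ge0 // lecR.
Qed.

(** * Induced subgraphs *)

Lemma mxsub_form (R : pzRingType) (m n : nat) (A : 'M[R]_n) (f : 'I_m -> 'I_n) :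
  rowsub f 1%:M *m A *m (rowsub f 1%:M)^T = mxsub f f A.
Proof.
rewrite mul_rowsub_mx mul1mx trmx_mxsub trmx1 mulmx_colsub mulmx1.
by apply/matrixP=> i j; rewrite !mxE.
Qed.

(** The form of the adjacency matrix at [s (a + 2 d) + t (b + c)] is
    [2 (s^2 + (s + t)^2)], so it is positive definite on the span of [a + 2 d] and
    [b + c]. With [a + d] in place of [a + 2 d] it would be [2 (s + t)^2], which is
    degenerate. *)
Lemma lambda2_gt0_paw (R : rcfType) (T : finType) (e : rel T) (a b c d : T) :
    symmetric e -> irreflexive e ->
    e a b -> e a c -> e b c -> e a d -> ~~ e b d -> ~~ e c d ->
  0 < lambda (adjacency R e) 2.
Proof.
move=> sym_e irr_e eab eac ebc ead /negPf ebd /negPf ecd; apply: lambda_gt0.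
pose f (i : 'I_4) := enum_rank (nth a [:: a; b; c; d] i).
pose W : 'M[R]_(2, 4) :=
  \matrix_(i, j) nth 0 (nth [::] [:: [:: 1; 0; 0; 2]; [:: 0; 1; 1; 0]] i) j.
apply: (@eigenvalues_posdef _ _ _ _ (W *m rowsub f 1%:M)).
  by apply/matrixP=> i j; rewrite !mxE sym_e.
move=> v vN0.
have -> : W *m rowsub f 1%:M *m adjacency R e *m (W *m rowsub f 1%:M)^T =
    W *m mxsub f f (adjacency R e) *m W^T.
  by rewrite trmx_mul -mxsub_form !mulmxA.
have -> : (v *m (W *m mxsub f f (adjacency R e) *m W^T) *m v^T) 0 0 =
    2 * (v 0 0 ^+ 2 + (v 0 0 + v 0 1) ^+ 2).
  rewrite !(mxE, big_ord_recl, big_ord0) /= !enum_rankK /=.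
  rewrite !irr_e ![e _ a]sym_e ![e d _]sym_e ![e c b]sym_e.
  rewrite eab eac ebc ead ebd ecd.
  have -> : lift ord0 ord0 = 1 :> 'I_2 by apply/val_inj.
  by rewrite /=; ring.
rewrite mulr_gt0 // lt_neqAle addr_ge0 ?sqr_ge0 // andbT eq_sym.
rewrite paddr_eq0 ?sqr_ge0 // !sqrf_eq0; apply: contra vN0 => /andP[/eqP v0].
rewrite v0 add0r => /eqP v1; apply/eqP/rowP; case=> [[|[|//]] lt_i]; rewrite mxE.
  by rewrite -[RHS]v0; congr (v _ _); exact: val_inj.
by rewrite -[RHS]v1; congr (v _ _); exact: val_inj.
Qed.

(** * Power graphs *)

Local Open Scope group_scope.

Lemma exists_two_primes (n : nat) : (0 < n)%N ->
    ~ (exists p m : nat, prime p /\ n = (p ^ m)%N) ->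
  exists p q : nat, [/\ prime p, prime q, (p %| n)%N, (q %| n)%N & p != q].
Proof.
move=> n_gt0 not_ppow.
have n_gt1 : (1 < n)%N.
  rewrite ltn_neqAle n_gt0 andbT; apply/eqP=> n1.
  (* The order 1 is the prime power 2 ^ 0. *)
  by apply: not_ppow; exists 2, 0%N; rewrite -n1.
have pr_p := pdiv_prime n_gt1; exists (pdiv n).
have : ~~ (pdiv n).-nat n.
  by apply/negP=> /p_natP[m nE]; apply: not_ppow; exists (pdiv n), m.
rewrite /pnat n_gt0 /= => /allPn[q]; rewrite mem_primes => /and3P[pr_q _ q_n].
by rewrite inE /= => qNp; exists q; split; rewrite ?pdiv_dvd // eq_sym.
Qed.

Lemma power_graph_sym (gT : finGroupType) : symmetric (@power_graph gT).
Proof. by move=> x y; rewrite /power_graph /= eq_sym orbC. Qed.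

Lemma power_graph_irr (gT : finGroupType) : irreflexive (@power_graph gT).
Proof. by move=> x; rewrite /power_graph /= eqxx. Qed.

Lemma power_graph1 (gT : finGroupType) (x : gT) :
  power_graph 1 x = (x != 1).
Proof. by rewrite /power_graph /= group1 eq_sym andbT. Qed.

Lemma power_graph_dvdn_order (gT : finGroupType) (x y : gT) :
  power_graph x y -> (#[x] %| #[y])%N || (#[y] %| #[x])%N.
Proof. by case/andP=> _ /orP[] /order_dvdG ->; rewrite ?orbT. Qed.

(** With [x] of order [p] and [y] of order [q], the elements [1, x, x^-1, y]
    induce a paw; [p] has to be odd for [x] and [x^-1] to differ. *)
Lemma lambda2_power_graph_gt0 (R : rcfType) (gT : finGroupType) (p q : nat) :
    prime p -> prime q -> (2 < p)%N -> p != q ->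
    (p %| #|gT|)%N -> (q %| #|gT|)%N ->
  (0 < lambda (adjacency R (@power_graph gT)) 2)%R.
Proof.
move=> pr_p pr_q p_gt2 pNq p_dvd q_dvd.
have [x _ ox] : {x : gT | x \in [set: gT] & #[x] = p}.
  by apply: Cauchy; rewrite ?cardsT.
have [y _ oy] : {y : gT | y \in [set: gT] & #[y] = q}.
  by apply: Cauchy; rewrite ?cardsT.
have not_adj z : #[z] = p -> ~~ power_graph z y.
  move=> oz; apply: contra pNq => /power_graph_dvdn_order.
  by rewrite oz oy !dvdn_prime2 // [q == p]eq_sym orbb.
have N1 z : (1 < #[z])%N -> z != 1.
  by apply: contraTneq => ->; rewrite order1.
apply: (@lambda2_gt0_paw _ _ _ 1 x x^-1 y); rewrite ?power_graph1 ?N1 ?orderV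
  ?ox ?oy ?prime_gt1 ?not_adj ?orderV //.
- exact: power_graph_sym.
- exact: power_graph_irr.
rewrite /power_graph /= groupV cycle_id orbT andbT.
apply: contraTneq p_gt2 => x_inv; rewrite -leqNgt -ox dvdn_leq //.
by rewrite order_dvdn expgS expg1 {1}x_inv mulVg.
Qed.

Local Open Scope ring_scope.

Theorem theorem2p3 (R : rcfType) (n : nat) (gT : finGroupType)
    (n_gt0 : (0 < n)%N)
    (n_not_ppow : ~ exists p m : nat, prime p /\ n = (p ^ m)%N)
    (gT_cyclic : cyclic [set: gT]) (card_gT : #|gT| = n) :
  0 < lambda (adjacency R (@power_graph gT)) 2.
Proof.
have [p [q []]] := exists_two_primes n_gt0 n_not_ppow.
rewrite -card_gT => pr_p pr_q p_dvd q_dvd pNq.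
have [p_gt2|p_le2] := ltnP 2 p.
  exact: (lambda2_power_graph_gt0 R pr_p pr_q).
have p2 : p = 2 by apply/eqP; rewrite eqn_leq p_le2 prime_gt1.
have q_gt2 : (2 < q)%N.
  by move: pNq (prime_gt1 pr_q); rewrite p2; case: q {pr_q q_dvd} => [|[|[|]]].
by apply: (lambda2_power_graph_gt0 R pr_q pr_p); rewrite // eq_sym.
Qed.
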